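(* Let $0<\delta<1/8$ and let $G=(V,E)$ be a $\delta$-good expander on $n$ vertices. Then there is a deterministic identification procedure for $G$ (that is, a map taking each report profile $r$ on $G$ to a pair of disjoint sets $T'=T'(r)$, $B'=B'(r)\subseteq V$) such that for every partition $V=T\cup B$, $T\cap B=\emptyset$, with $|T|>|B|$, and every report profile $r$ consistent with $(T,B)$, we have $T'(r)\subseteq T$, $B'(r)\subseteq B$ and $|T'(r)\cup B'(r)|>(1-\delta)n$. That is, from the reports one can recover the type of almost all vertices of $G$. Moreover, if $|T|>(1/2+\delta)n$, then there is an algorithm running in time linear in the size of $G$ which, given $G$ and a report profile consistent with $(T,B)$, outputs sets $T'\subseteq T$ and $B'\subseteq B$ with $|T'\cup B'|>(1-\delta)n$.
   Context: Corruption detection model (undirected case). $G=(V,E)$ is a finite undirected graph. Its vertex set is partitioned as $V=T\cup B$, $T\cap B=\emptyset$: vertices in $T$ are called truthful and vertices in $B$ corrupt. Every vertex $u$ reports on each of its neighbors $v$ whether $v$ is truthful or corrupt. A report profile is a function $r$ assigning to every ordered pair $(u,v)$ with $\{u,v\}\in E$ a value $r(u,v)\in\{\text{truthful},\text{corrupt}\}$, interpreted as $u$'s report about $v$. A report profile $r$ is consistent with the partition $(T,B)$ if for every $u\in T$ and every neighbor $v$ of $u$, $r(u,v)$ equals the true type of $v$. There is no constraint on reports made by corrupt vertices: they may be arbitrary and coordinated. For $0<\delta<1/8$, a graph $G=(V,E)$ on $n$ vertices is a $\delta$-good expander if (1) every set $U\subseteq V$ with $|U|\le 2\delta n$ has more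 than $|U|$ neighbors outside $U$, and (2) for any two sets of vertices $A,C$ with $|A|\ge \delta n$ and $|C|\ge n/4$ there is an edge of $G$ with one endpoint in $A$ and the other in $C$. *)

(* Defs.v *)
From HB Require Import structures.
From mathcomp Require Import all_boot all_order all_algebra.

Set Implicit Arguments.
Unset Strict Implicit.
Unset Printing Implicit Defensive.

Import Order.TTheory GRing.Theory Num.Theory.

Record sgraph (V : finType) := SGraph {
  adjacent :> rel V;
  adjacent_sym : symmetric adjacent;
  adjacent_irrefl : irreflexive adjacent }.

Section Graphs.
Variables (V : finType) (G : sgraph V).

Definition edges : {set {set V}} :=
  [set [set p.1; p.2] | p : V * V & G p.1 p.2].

Definition graph_size : nat := #|V| + #|edges|.

Definition outer_nbrs (U : {set V}) : {set V} :=
  [set v | (v \notin U) && [exists u in U, G u v]].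

Definition nbr (u : V) : Type := {v : V | G u v}.

End Graphs.

Local Open Scope ring_scope.

(* The expansion condition is required of nonempty sets only: the empty set
   has no neighbors, so with U = set0 allowed no graph would qualify.
   In the second condition A and C need not be disjoint. *)
Definition good_expander (R : realFieldType) (delta : R)
    (V : finType) (G : sgraph V) : Prop :=
  (forall U : {set V}, U != set0 -> #|U|%:R <= 2 * delta * #|V|%:R ->
     (#|U| < #|outer_nbrs G U|)%N)
  /\ (forall A C : {set V},
     delta * #|V|%:R <= #|A|%:R -> #|V|%:R / 4 <= #|C|%:R :> R ->
     exists a c : V, [/\ a \in A, c \in C & G a c]).

Local Close Scope ring_scope.

Inductive status := Truthful | Corrupt.

Definition report_profile (V : finType) (G : sgraph V) : Type :=
  forall u : V, nbr G u -> status.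

Definition bipartition (V : finType) (T B : {set V}) : Prop :=
  T :|: B = [set: V] /\ T :&: B = set0.

Definition consistent (V : finType) (G : sgraph V)
    (r : report_profile G) (T B : {set V}) : Prop :=
  forall u, u \in T -> forall v : nbr G u,
    (sval v \in T -> r u v = Truthful) /\ (sval v \in B -> r u v = Corrupt).

(* Machine model: a unit-cost successor RAM, as structured programs over
   integer arrays.  [m a i] is cell i of array a; only finitely many arrays
   occur in a given program, and scalar variables are cells at index 0.  The
   only arithmetic is +1 and -1, so in t steps no number exceeds the largest
   number of the input and the program by more than t: every unit-cost step
   acts on words of logarithmic length. *)
Definition memory := nat -> nat -> nat.

Inductive expr :=
| Lit of nat
| Cell of nat & expr
| Succ of expr
| Pred of expr.

Inductive test :=
| Eq of expr & expr
| Lt of expr & expr.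

Inductive cmd :=
| Skip
| Store of nat & expr & expr
| Seq of cmd & cmd
| If of test & cmd & cmd
| While of test & cmd.

Fixpoint eval (m : memory) (e : expr) : nat :=
  match e with
  | Lit k => k
  | Cell a i => m a (eval m i)
  | Succ e => (eval m e).+1
  | Pred e => (eval m e).-1
  end.

Definition holds (m : memory) (b : test) : bool :=
  match b with
  | Eq e1 e2 => eval m e1 == eval m e2
  | Lt e1 e2 => eval m e1 < eval m e2
  end.

Fixpoint expr_cost (e : expr) : nat :=
  match e with
  | Lit _ => 1
  | Cell _ e | Succ e | Pred e => (expr_cost e).+1
  end.

Definition test_cost (b : test) : nat :=
  match b with Eq e1 e2 | Lt e1 e2 => (expr_cost e1 + expr_cost e2).+1 end.

Definition update (m : memory) (a i x : nat) : memory :=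
  fun a' i' => if (a' == a) && (i' == i) then x else m a' i'.

(* [exec c m t m']: started in memory m, program c halts after exactly t
   elementary steps, in memory m'. *)
Inductive exec : cmd -> memory -> nat -> memory -> Prop :=
| exec_skip m : exec Skip m 1 m
| exec_store a i e m :
    exec (Store a i e) m (expr_cost i + expr_cost e).+1
      (update m a (eval m i) (eval m e))
| exec_seq c1 c2 m1 m2 m3 t1 t2 :
    exec c1 m1 t1 m2 -> exec c2 m2 t2 m3 -> exec (Seq c1 c2) m1 (t1 + t2) m3
| exec_if b c1 c2 m m' t :
    exec (if holds m b then c1 else c2) m t m' ->
    exec (If b c1 c2) m (test_cost b + t) m'
| exec_while_stop b c m :
    ~~ holds m b -> exec (While b c) m (test_cost b) m
| exec_while_step b c m1 m2 m3 t1 t2 :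
    holds m1 b -> exec c m1 t1 m2 -> exec (While b c) m2 t2 m3 ->
    exec (While b c) m1 (test_cost b + t1 + t2) m3.

Lemma exec_det c m t1 m1 t2 m2 :
  exec c m t1 m1 -> exec c m t2 m2 -> t1 = t2 /\ m1 = m2.
Proof.
move=> H; elim: H t2 m2 => {c m t1 m1}.
- by move=> m t2 m2 H; inversion H.
- by move=> a i e m t2 m2 H; inversion H.
- move=> c1 c2 m1 m2 m3 t1 t2 _ IH1 _ IH2 t m H.
  inversion H as [| |? ? ? m2' ? t1' t2' E1 E2| | |]; subst.
  have [-> E] := IH1 _ _ E1; rewrite -E in E2.
  by have [-> ->] := IH2 _ _ E2.
- move=> b c1 c2 m m' t _ IH t2 m2 H.
  inversion H as [| | |? ? ? ? ? t' E| |]; subst.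
  by have [-> ->] := IH _ _ E.
- move=> b c m /negbTE Hb t2 m2 H.
  inversion H as [| | | | |? ? ? ? ? ? ? Hb']; subst => //.
  by rewrite Hb in Hb'.
- move=> b c m1 m2 m3 t1 t2 Hb _ IH1 _ IH2 t m H.
  inversion H as [| | | |? ? ? Hb'|? ? ? m2' ? t1' t2' Hb' E1 E2]; subst.
    by rewrite Hb in Hb'.
  have [-> E] := IH1 _ _ E1; rewrite -E in E2.
  by have [-> ->] := IH2 _ _ E2.
Qed.

(* The vertices are numbered 0, ..., #|V|-1 by [enum_rank]; the order of each
   adjacency list is arbitrary. *)
Definition adjacency_lists (V : finType) (G : sgraph V)
    (adj : forall u : V, seq (nbr G u)) : Prop :=
  forall u, uniq (adj u) /\ forall v : nbr G u, v \in adj u.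

Definition status_code (x : status) : nat :=
  match x with Truthful => 1 | Corrupt => 2 end.

Definition memory_of (arrays : seq (seq nat)) : memory :=
  fun a i => nth 0 (nth [::] arrays a) i.

(* Array 0 holds the number of vertices.  The adjacency lists are concatenated
   in array 2, the list of vertex i occupying the positions k with
   off i <= k < off i.+1, where off is array 1; array 3 holds at position k the
   report of i on the neighbor listed at position k.  All else is 0. *)
Definition input (V : finType) (G : sgraph V) (r : report_profile G)
    (adj : forall u : V, seq (nbr G u)) : memory :=
  memory_of
    [:: [:: #|V|];
        [seq sumn (take i [seq size (adj u) | u <- enum V])
           | i <- iota 0 #|V|.+1];
        [seq enum_rank (sval v) : nat | u <- enum V, v <- adj u];
        [seq status_code (r u v) | u <- enum V, v <- adj u]].

(* The output is read off array 4. *)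
Definition output (V : finType) (m : memory) (x : status) : {set V} :=
  [set v : V | m 4 (enum_rank v) == status_code x].

(* Main.v *)
Require Import Defs.
From HB Require Import structures.
From mathcomp Require Import all_boot all_order all_algebra.
From mathcomp Require Import zify lra.

Set Implicit Arguments.
Unset Strict Implicit.
Unset Printing Implicit Defensive.

Import Order.TTheory GRing.Theory Num.Theory.

(** Since a vertex set with n/4 vertices is adjacent to all but fewer than
    delta n vertices, a majority set T contains a component K of G[T] with more
    than |T| - delta n vertices, and K together with its outer neighbors (all
    corrupt) covers more than (1 - delta) n vertices.  So it is enough to find K.

    If T1 and T2 are majority sets consistent with the same reports, no edge
    leaves the intersection of T1 and T2 towards exactly one of them.  If their
    giant components differed, the intersection W would be disjoint from both,
    hence of size less than delta n, and have all its outer neighbors outside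
    the union of T1 and T2, a set of fewer than |W| vertices; this contradicts
    expansion.  So the reports determine K.

    For the linear-time algorithm, K has more than n/2 vertices, is strongly
    connected under "u reports v truthful", and no such arc leaves K.  Hence a
    depth-first search of all the vertices visits K without interruption once it
    has entered it, and the vertex visited in the middle belongs to K.  A second
    search, from that vertex, visits exactly K. *)

(** * Components of the truthful part *)

Section Components.
Variables (V : finType) (G : sgraph V).
Implicit Types (T S : {set V}) (x u v : V).

Definition inner_edge T : rel V := [rel u v | [&& G u v, u \in T & v \in T]].

Definition component T x : {set V} := [set v | connect (inner_edge T) x v].

(** For S inside T: S is a union of components of G[T]. *)
Definition closed_in T S : Prop :=
  forall u v, u \in S -> v \in T -> G u v -> v \in S.

(** The trace of a common report profile: a vertex truthful under both sets makes one report on v,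
    and it is correct under both. *)
Definition agree T1 T2 : Prop :=
  forall u v, u \in T1 -> u \in T2 -> G u v -> (v \in T1) = (v \in T2).

Lemma agree_sym T1 T2 : agree T1 T2 -> agree T2 T1.
Proof. by move=> H u v u2 u1 /(H _ _ u1 u2) ->. Qed.

Lemma component_id T x : x \in component T x.
Proof. by rewrite inE connect0. Qed.

Lemma component_sub T x : x \in T -> component T x \subset T.
Proof.
move=> xT; apply/subsetP => v; rewrite inE => /connectP[p].
by elim: p x xT => [|y p IH] x xT /= => [_ -> | /andP[/and3P[_ _ yT]] /IH]; auto.
Qed.

Lemma component_closed T x : x \in T -> closed_in T (component T x).
Proof.
move=> xT u v uK vT uv; have uT := subsetP (component_sub xT) u uK.
move: uK; rewrite !inE => /connect_trans; apply; apply: connect1.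
by rewrite /inner_edge /= uv uT vT.
Qed.

Lemma component_min T S x :
  x \in S -> closed_in T S -> component T x \subset S.
Proof.
move=> xS clS; apply/subsetP => v; rewrite inE => /connectP[p].
elim: p x xS => [|y p IH] x xS /= => [_ -> // | /andP[/and3P[xy _ yT]]].
by apply: IH; apply: clS yT xy.
Qed.

Lemma inner_edge_sym T : connect_sym (inner_edge T).
Proof.
apply: sym_connect_sym => u v.
by rewrite /inner_edge /= adjacent_sym andbA andbAC -andbA.
Qed.

Lemma component_eq T x y : y \in component T x -> component T y = component T x.
Proof.
rewrite inE => xy; apply/setP => v; rewrite !inE.
by rewrite (same_connect (inner_edge_sym T) xy).
Qed.

Lemma closed_in_setD T S1 S2 :
  S2 \subset T -> closed_in T S1 -> closed_in T S2 -> closed_in T (S2 :\: S1).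
Proof.
move=> /subsetP s2T cl1 cl2 u v; rewrite !inE => /andP[u1 u2] vT uv.
rewrite (cl2 u v u2 vT uv) andbT; apply: contra u1 => v1.
by apply: cl1 v1 (s2T _ u2) _; rewrite adjacent_sym.
Qed.

(** By agreement, a T1-neighbor of a common vertex lies in T2 as well, so the part of T1 inside the
    T2-component of x is closed in T1. *)
Lemma agree_component_sub T1 T2 x :
  agree T1 T2 -> x \in T1 -> x \in T2 ->
  component T1 x \subset T2 /\ component T1 x \subset component T2 x.
Proof.
move=> agr x1 x2; have sub : component T1 x \subset T1 :&: component T2 x.
  apply: component_min; first by rewrite inE x1 component_id.
  move=> u v; rewrite inE => /andP[u1 uK] v1 uv; rewrite inE v1 /=.
  have u2 := subsetP (component_sub x2) u uK.
  by apply: (component_closed x2 uK _ uv); rewrite -(agr u v u1 u2 uv).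
have := subset_trans sub (subsetIr _ _) => sub2.
by split=> //; apply: subset_trans sub2 (component_sub x2).
Qed.

Lemma agree_component_eq T1 T2 x :
  agree T1 T2 -> x \in T1 -> x \in T2 -> component T1 x = component T2 x.
Proof.
move=> agr x1 x2; apply/eqP; rewrite eqEsubset.
rewrite (agree_component_sub agr x1 x2).2.
by rewrite (agree_component_sub (agree_sym agr) x2 x1).2.
Qed.

Lemma outer_nbrs_component T x :
  x \in T -> outer_nbrs G (component T x) \subset ~: T.
Proof.
move=> xT; apply/subsetP => v; rewrite !inE => /andP[vK /exists_inP[u uK uv]].
by apply: contra vK => vT; have := component_closed xT uK vT uv; rewrite inE.
Qed.

Lemma outer_nbrs_disjoint S : S :&: outer_nbrs G S = set0.
Proof. by apply/setP => v; rewrite !inE; case: (v \in S). Qed.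

End Components.

Local Open Scope ring_scope.

(** * Giant components in a good expander *)

Section Expander.
Variables (R : realFieldType) (delta : R).
Hypotheses (delta_gt0 : 0 < delta) (delta_lt : delta < 1 / 8).
Variables (V : finType) (G : sgraph V).
Hypothesis expG : good_expander delta G.
Implicit Types (T S : {set V}) (x : V).

Let n : R := #|V|%:R.

Lemma nonadjacent_small S (A : {set V}) : (#|V| <= 4 * #|S|)%N ->
  (forall u v, u \in S -> v \in A -> ~~ G u v) -> #|A|%:R < delta * n.
Proof.
move=> bigS noedge; rewrite ltNge; apply/negP => bigA.
have [|a [c [aA cS ac]]] := expG.2 A S bigA.
  by move: bigS; rewrite -(ler_nat R) natrM => ?; lra.
by have /negP[] := noedge c a cS aA; rewrite adjacent_sym.
Qed.

Lemma closed_co_small T S : S \subset T -> closed_in G T S ->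
  (#|V| <= 4 * #|S|)%N -> #|T :\: S|%:R < delta * n.
Proof.
move=> sST clS bigS; apply: nonadjacent_small bigS _ => u v uS.
by rewrite inE => /andP[vS vT]; apply: contra vS => uv; apply: clS uv.
Qed.

(* A minimal union of components of G[T] with at least n/4 vertices is a single
   component: otherwise, removing one component D from it leaves a set with
   fewer than n/4, hence fewer than delta n vertices, and |T| < n/4 + 2 delta n. *)
Lemma giant_component T : (#|V| < 2 * #|T|)%N ->
  exists2 x, x \in T & #|T|%:R - delta * n < #|component G T x|%:R.
Proof.
move=> bigT.
pose P := [pred S : {set V} | [&& S \subset T, (#|V| <= 4 * #|S|)%N &
  [forall u in S, forall v in T, G u v ==> (v \in S)]]].
have closedP S : reflect (closed_in G T S)
    [forall u in S, forall v in T, G u v ==> (v \in S)].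
  apply: (iffP forall_inP) => [H u v uS vT uv | H u uS].
    by have /forall_inP/(_ v vT)/implyP/(_ uv) := H u uS.
  by apply/forall_inP => v vT; apply/implyP => uv; apply: H uv.
have PT : P T.
  by apply/and3P; split; [exact: subxx | lia | apply/closedP => u v].
case: (arg_minnP (fun S => #|S|) PT) => S /and3P[sST bigS /closedP clS] minS.
have V_gt0 : (0 < #|V|)%N by have := subset_leq_card (subsetT T); rewrite cardsT; lia.
have [x xS] : exists x, x \in S by apply/set0Pn; rewrite -card_gt0; lia.
have xT := subsetP sST x xS; exists x => //.
set D := component G T x.
have DS : D \subset S by exact: component_min.
have clD : closed_in G T D by exact: component_closed.
have D_gt0 : (0 < #|D|)%N by apply/card_gt0P; exists x; rewrite component_id.
have cTD := cardsDS (subset_trans DS sST); have cTS := cardsDS sST.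
have cSD := cardsDS DS; have leDS := subset_leq_card DS.
have leST := subset_leq_card sST.
case: (leqP #|V| (4 * #|D|)) => bigD.
  have := closed_co_small (subset_trans DS sST) clD bigD.
  by rewrite cTD natrB; [lra | lia].
have sSDT : S :\: D \subset T by rewrite (subset_trans (subsetDl _ _)).
have clSD : closed_in G T (S :\: D) by exact: closed_in_setD.
have smallSD : (4 * #|S :\: D| < #|V|)%N.
  rewrite ltnNge; apply/negP => big; have := minS (S :\: D).
  have PSD : P (S :\: D) by rewrite /= sSDT big; apply/closedP.
  by move/(_ PSD); rewrite cSD; lia.
have cTSD := cardsDS sSDT.
(* T without S \ D is again a union of components and keeps more than n/4 vertices; what it misses
   of T is S \ D. *)
have : #|T :\: (T :\: (S :\: D))|%:R < delta * n.
  apply: closed_co_small; first exact: subsetDl.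
    by apply: closed_in_setD => // u v uT vT.
  by have := subset_leq_card sSDT; lia.
rewrite setDDr setDv set0U (setIidPr sSDT).
have := closed_co_small sST clS bigS.
have : #|T|%:R = #|T :\: S|%:R + #|S :\: D|%:R + #|D|%:R :> R.
  by rewrite -!natrD; congr (_%:R); lia.
move: bigT bigD; rewrite -!(ltr_nat R) !natrM -/n.
have : delta * n <= 1 / 8 * n by rewrite ler_wpM2r ?ler0n // ltW.
lra.
Qed.

(** More than n/2 - n/8 vertices remain. The weaker bound n/4 is what the second expansion condition
    asks of C, and it is free of [delta], so that [identify] can test it. *)
Lemma giant_component_quarter T : (#|V| < 2 * #|T|)%N ->
  exists2 x, x \in T & (#|V| <= 4 * #|component G T x|)%N.
Proof.
move=> bigT; have [x xT bigK] := giant_component bigT; exists x => //.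
rewrite -(ler_nat R) natrM -/n.
have : delta * n <= 1 / 8 * n by rewrite ler_wpM2r ?ler0n // ltW.
have : 0 <= n by rewrite ler0n.
by move: bigT; rewrite -(ltr_nat R) natrM -/n; lra.
Qed.

Lemma giant_component_unique T1 T2 x1 x2 : agree G T1 T2 ->
  (#|V| < 2 * #|T1|)%N -> (#|V| < 2 * #|T2|)%N -> x1 \in T1 -> x2 \in T2 ->
  (#|V| <= 4 * #|component G T1 x1|)%N -> (#|V| <= 4 * #|component G T2 x2|)%N ->
  component G T1 x1 = component G T2 x2.
Proof.
move=> agr maj1 maj2 x1T x2T big1 big2.
set K1 := component G T1 x1; set K2 := component G T2 x2.
have sK1 : K1 \subset T1 by exact: component_sub.
have [/eqP d21 | /set0Pn[y]] := boolP (T2 :&: K1 == set0); last first.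
  (* Agreement at y puts all of K1 inside T2. Expansion gives an edge from some a in K1 to K2; as a
     lies in T2, it belongs to K2, and both components are that of a. *)
  rewrite in_setI => /andP[y2 yK1]; have y1 := subsetP sK1 y yK1.
  have [sub _] := agree_component_sub agr y1 y2; rewrite (component_eq yK1) in sub.
  have [||a [c [aK1 cK2 ac]]] := expG.2 K1 K2.
  - apply: (@le_trans _ _ (1 / 4 * n)).
      by rewrite ler_wpM2r ?ler0n //; move: delta_lt; lra.
    by move: big1; rewrite -(ler_nat R) natrM -/n -/K1; lra.
  - by move: big2; rewrite -(ler_nat R) natrM -/n -/K2; lra.
  have a2 := subsetP sub a aK1; have a1 := subsetP sK1 a aK1.
  have aK2 : a \in K2.
    by apply: component_closed cK2 a2 _ => //; rewrite adjacent_sym.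
  rewrite /K1 /K2 -(component_eq aK1) -(component_eq aK2).
  exact: agree_component_eq.
(* W is small, as it misses K1; by agreement all its outer neighbors lie outside
   both T1 and T2, where fewer than |W| vertices are left: this contradicts
   expansion. *)
exfalso.
pose W := T1 :&: T2; pose N := ~: (T1 :|: T2).
(* Two majorities have sizes adding up to more than n, so by inclusion-exclusion fewer than |W|
   vertices lie outside their union. *)
have cU : (#|T1 :|: T2| + #|W| = #|T1| + #|T2|)%N 
  by rewrite cardsU /W; have := subset_leq_card (subsetIl T1 T2); lia.
have cN := cardsC (T1 :|: T2).
have ltNW : (#|N| < #|W|)%N by rewrite /N; lia.
have small1 := closed_co_small sK1 (component_closed x1T) big1.
have WK : W \subset T1 :\: K1.
  apply/subsetP => w; rewrite !inE => /andP[w1 w2]; rewrite w1 andbT.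
  by apply/negP => wK; have := in_set0 w; rewrite -d21 !inE w2 => /negP[].
have : (#|outer_nbrs G W| <= #|W|)%N.
  apply: leq_trans (ltnW ltNW); apply: subset_leq_card.
  apply/subsetP => v; rewrite !inE => /andP[vW /exists_inP[w]].
  rewrite inE => /andP[w1 w2 /(agr _ _ w1 w2) e].
  by move: vW; rewrite e orbb andbb.
rewrite leqNgt => /negP; apply; apply: expG.1; first by rewrite -card_gt0; lia.
have := subset_leq_card WK; rewrite -(ler_nat R) -/n.
have : 0 <= delta * n by rewrite mulr_ge0 ?ler0n // ltW.
by move: small1; rewrite -mulrA; lra.
Qed.

(** The uncovered vertices have no neighbor in S, so expansion bounds their number. *)
Lemma component_nbrs_cover S : (#|V| <= 4 * #|S|)%N ->
  (1 - delta) * n < #|S :|: outer_nbrs G S|%:R.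
Proof.
move=> bigS; have : #|~: (S :|: outer_nbrs G S)|%:R < delta * n.
  apply: nonadjacent_small bigS _ => u v uS; rewrite !inE negb_or => /andP[vS].
  rewrite vS /=; apply: contra => uv; apply/exists_inP; by exists u.
have : n = #|S :|: outer_nbrs G S|%:R + #|~: (S :|: outer_nbrs G S)|%:R.
  by rewrite -natrD cardsC.
by rewrite mulrBl mul1r; lra.
Qed.

End Expander.

(** * Identification by exhaustive search *)

Section Procedure.
Variables (V : finType) (G : sgraph V).
Implicit Types (r : report_profile G) (T B : {set V}).

Definition truthful (x : status) : bool := if x is Truthful then true else false.

(** Decidable consistency with T and its complement, so that candidates for T can be searched
    for. *)
Definition consistentb r T : bool :=
  [forall u in T, forall v : {v | G u v}, truthful (r u v) == (sval v \in T)].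

Lemma consistentbP r T B : bipartition T B -> consistent r T B -> consistentb r T.
Proof.
move=> [TUB TIB] con; apply/forall_inP => u uT; apply/forallP => v.
have [conT conB] := con u uT v; have [/conT -> // | vT] := boolP (sval v \in T).
by have := in_setT (sval v); rewrite -TUB inE (negPf vT) => /conB ->.
Qed.

Lemma consistentb_agree r T1 T2 :
  consistentb r T1 -> consistentb r T2 -> agree G T1 T2.
Proof.
move=> con1 con2 u v u1 u2 uv.
have /forallP/(_ (exist _ v uv))/eqP <- := forall_inP con1 u u1.
by have /forallP/(_ (exist _ v uv))/eqP <- := forall_inP con2 u u2.
Qed.

(** Any consistent majority set with any of its quarter-sized components will do, by
    [giant_component_unique]. The default keeps the two sets disjoint for every profile. *)
Definition identify r : {set V} * {set V} :=
  if [pick p : {set V} * V | [&& consistentb r p.1, #|V| < 2 * #|p.1|,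
        p.2 \in p.1 & #|V| <= 4 * #|component G p.1 p.2|]]%N is Some p
  then (component G p.1 p.2, outer_nbrs G (component G p.1 p.2))
  else (set0, set0).

Lemma identify_disjoint r : (identify r).1 :&: (identify r).2 = set0.
Proof.
by rewrite /identify; case: pickP => *; rewrite ?outer_nbrs_disjoint ?set0I.
Qed.

End Procedure.

Lemma bipartition_setC (V : finType) (T B : {set V}) :
  bipartition T B -> B = ~: T.
Proof.
case=> TUB TIB; apply/setP => v; move/setP/(_ v): TUB; move/setP/(_ v): TIB.
by rewrite !inE; case: (v \in T); case: (v \in B).
Qed.

Lemma identifyP (R : realFieldType) (delta : R) (V : finType) (G : sgraph V)
    (r : report_profile G) (T B : {set V}) :
  0 < delta -> delta < 1 / 8 -> good_expander delta G ->
  bipartition T B -> (#|B| < #|T|)%N -> consistent r T B ->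
  [/\ (identify r).1 \subset T, (identify r).2 \subset B
    & (1 - delta) * #|V|%:R < #|(identify r).1 :|: (identify r).2|%:R].
Proof.
move=> d_gt0 d_lt expG bip maj con.
have conb := consistentbP bip con; have eB := bipartition_setC bip.
have maj2 : (#|V| < 2 * #|T|)%N by have := cardsC T; rewrite -eB; lia.
have [x xT bigK] := giant_component_quarter d_gt0 d_lt expG maj2.
rewrite /identify; case: pickP => [[T' y] /= | /(_ (T, x))] /=; last first.
  by rewrite conb maj2 xT bigK.
case/and4P=> conb' maj' yT' bigK'.
(* The set T' found may differ from T; only the giant component is common to them. *)
have -> : component G T' y = component G T x.
  have agr := consistentb_agree conb' conb.
  exact: (giant_component_unique d_gt0 d_lt expG agr).
split; first exact: component_sub.
  by rewrite eB outer_nbrs_component.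
exact: component_nbrs_cover.
Qed.

Local Close Scope ring_scope.

(** * Cost-aware program logic *)

(* [p] is a stock of time credits: the run of [c] and what is left for the
   continuation [Q] are paid from it. *)
Definition run (c : cmd) (m : memory) (p : nat) (Q : nat -> memory -> Prop) : Prop :=
  exists t m' p', [/\ exec c m t m', t + p' <= p & Q p' m'].

Section Rules.
Implicit Types (c : cmd) (m : memory) (Q : nat -> memory -> Prop).

(** A frame rule for credits: a specification with its own budget [p0] is used inside a larger
    stock, and the remaining credits pass to the continuation. *)
Lemma run_weaken c m p0 p (Q0 : memory -> Prop) Q :
  run c m p0 (fun=> Q0) -> p0 <= p ->
  (forall m', Q0 m' -> Q (p - p0) m') -> run c m p Q.
Proof.
move=> [t [m' [p' [E tp HQ]]]] le H; exists t, m', (p - p0).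
by split; [exact: E | lia | exact: H].
Qed.

Lemma run_skip m p Q : 1 <= p -> Q (p - 1) m -> run Skip m p Q.
Proof.
by move=> le HQ; exists 1, m, (p - 1); split=> //; [exact: exec_skip | lia].
Qed.

Lemma run_store a i e m p Q : (expr_cost i + expr_cost e).+1 <= p ->
  Q (p - (expr_cost i + expr_cost e).+1) (update m a (eval m i) (eval m e)) ->
  run (Store a i e) m p Q.
Proof.
move=> le HQ; eexists _, _, _; split; [exact: exec_store | | exact: HQ].
by lia.
Qed.

Lemma run_seq c1 c2 m p Q :
  run c1 m p (fun p' m' => run c2 m' p' Q) -> run (Seq c1 c2) m p Q.
Proof.
move=> [t1 [m1 [p1 [E1 le1 [t2 [m2 [p2 [E2 le2 HQ]]]]]]]].
by exists (t1 + t2), m2, p2; split=> //; [apply: exec_seq E1 E2 | lia].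
Qed.

Lemma run_if b c1 c2 m p Q : test_cost b <= p ->
  run (if holds m b then c1 else c2) m (p - test_cost b) Q ->
  run (If b c1 c2) m p Q.
Proof.
move=> le [t [m' [p' [E le' HQ]]]].
by exists (test_cost b + t), m', p'; split=> //; [apply: exec_if | lia].
Qed.

(* Every test costs a credit, so a loop that can pay for its runs terminates. *)
Lemma run_while (I : nat -> memory -> Prop) b c m p Q :
  (forall p' m', I p' m' -> test_cost b <= p' /\
     if holds m' b then run c m' (p' - test_cost b) I
     else Q (p' - test_cost b) m') ->
  I p m -> run (While b c) m p Q.
Proof.
move=> H; have [k] := ubnP p; elim: k p m => // k IH p m pk Ip.
have [le] := H p m Ip; case: ifPn => hb.
  move=> [t1 [m1 [p1 [E1 le1 I1]]]].
  have tb : 0 < test_cost b by case: (b).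
  have [|t2 [m2 [p2 [E2 le2 HQ]]]] := IH p1 m1 _ I1; first by lia.
  exists (test_cost b + t1 + t2), m2, p2; split=> //; last by lia.
  exact: exec_while_step E1 E2.
move=> HQ; exists (test_cost b), m, (p - test_cost b); split=> //.
  exact: exec_while_stop.
by lia.
Qed.

End Rules.

(** * The search program *)

(* Array 4 is the output array; arrays 6 and 8 hold the stack and the vertices
   in the order of their visit, of lengths [SP] and [CNT]. *)
Local Notation SP := 5.
Local Notation STACK := 6.
Local Notation CNT := 7.
Local Notation ORDER := 8.
Local Notation CUR := 9.
Local Notation POS := 10.
Local Notation HALF := 11.
Local Notation REST := 12.

Definition var (a : nat) : expr := Cell a (Lit 0).
Definition assign (a : nat) (e : expr) : cmd := Store a (Lit 0) e.

Definition scan (body : cmd) : cmd :=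
  Seq (assign POS (Cell 1 (var CUR)))
    (While (Lt (var POS) (Cell 1 (Succ (var CUR))))
       (Seq body (assign POS (Succ (var POS))))).

Definition push_if_trusted : cmd :=
  If (Eq (Cell 3 (var POS)) (Lit 1))
    (Seq (Store STACK (var SP) (Cell 2 (var POS))) (assign SP (Succ (var SP))))
    Skip.

(* The tag [g] differs from one search to the next, so that the marks left by the
   first search need not be erased. *)
Definition search (g : nat) : cmd :=
  While (Lt (Lit 0) (var SP))
    (Seq (assign SP (Pred (var SP)))
    (Seq (assign CUR (Cell STACK (var SP)))
    (If (Eq (Cell 4 (var CUR)) (Lit g)) Skip
      (Seq (Store 4 (var CUR) (Lit g))
      (Seq (Store ORDER (var CNT) (var CUR))
      (Seq (assign CNT (Succ (var CNT)))
        (scan push_if_trusted))))))).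

(** The value 1 marks vertices found by the second search. Any other value, including the tag 3 left
    by the first, gives way to the code of [Corrupt]. *)
Definition mark_unless_truthful : cmd :=
  If (Eq (Cell 4 (Cell 2 (var POS))) (Lit 1)) Skip
    (Store 4 (Cell 2 (var POS)) (Lit 2)).

Definition mark_neighbors : cmd :=
  While (Lt (Lit 0) (var CNT))
    (Seq (assign CNT (Pred (var CNT)))
    (Seq (assign CUR (Cell ORDER (var CNT)))
      (scan mark_unless_truthful))).

(** The first search starts with every vertex on the stack; [SP] also serves as the loop counter. *)
Definition push_all : cmd :=
  While (Lt (var SP) (Cell 0 (Lit 0)))
    (Seq (Store STACK (var SP) (var SP)) (assign SP (Succ (var SP)))).

(** With only +1 and -1 available, halving takes a loop of linear cost. *)
Definition halve : cmd :=
  Seq (assign HALF (Lit 0))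
  (Seq (assign REST (Cell 0 (Lit 0)))
    (While (Lt (Lit 1) (var REST))
       (Seq (assign REST (Pred (Pred (var REST))))
          (assign HALF (Succ (var HALF)))))).

(** The first tag, 3, is no status code; the second, 1, is the code of [Truthful], so the marks of
    the second search are already output. Resetting [CNT] makes [ORDER] list the second search
    only. *)
Definition identify_majority : cmd :=
  Seq push_all
  (Seq (search 3)
  (Seq halve
  (Seq (Store STACK (Lit 0) (Cell ORDER (var HALF)))
  (Seq (assign SP (Lit 1))
  (Seq (assign CNT (Lit 0))
  (Seq (search 1)
    mark_neighbors)))))).

(** * Correctness and cost of the subprograms *)

Section Machine.
Variables (V : finType) (G : sgraph V) (r : report_profile G).
Variable adj : forall u : V, seq (nbr G u).
Implicit Types (u v : V) (m : memory) (s o : seq V).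

Definition rank v : nat := enum_rank v.

Lemma rank_inj : injective rank.
Proof. by move=> u v /val_inj /enum_rank_inj. Qed.

Definition entries u : seq (V * status) := [seq (sval w, r w) | w : nbr G u <- adj u].

Definition trusted (d : seq (V * status)) : seq V :=
  [seq e.1 | e <- d & truthful e.2].

Lemma trusted_rcons d v x :
  trusted (rcons d (v, x)) = if truthful x then rcons (trusted d) v else trusted d.
Proof. by rewrite /trusted filter_rcons /=; case: truthful; rewrite ?map_rcons. Qed.

Definition offset u : nat :=
  sumn [seq size (entries w) | w <- take (rank u) (enum V)].

Definition stores_graph m : Prop :=
  [/\ m 0 0 = #|V|,
      forall u, m 1 (rank u) = offset u,
      forall u, m 1 (rank u).+1 = offset u + size (entries u)
    & forall u d v x d', entries u = d ++ (v, x) :: d' ->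
        m 2 (offset u + size d) = rank v /\
        m 3 (offset u + size d) = status_code x].

(** The head of the list sits at the highest index, so a push is a cons. [ORDER] is described in the
    same way, hence with the latest visit first. *)
Fixpoint stores_stack (f : nat -> nat) s : Prop :=
  if s is v :: s' then f (size s') = rank v /\ stores_stack f s' else True.

Lemma stores_stack_eq f f' s : (forall i, i < size s -> f' i = f i) ->
  stores_stack f s -> stores_stack f' s.
Proof.
elim: s => //= v s IH H [e Hs]; split; first by rewrite H.
by apply: IH Hs => i lt; apply: H; apply: ltnW.
Qed.

Lemma stores_stack_nth f s s' v :
  stores_stack f (s ++ v :: s') -> f (size s') = rank v.
Proof. by elim: s => [|w s IH] /= []. Qed.

Lemma stores_stack_push m a s v : stores_stack (m a) s ->
  stores_stack (update m a (size s) (rank v) a) (v :: s).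
Proof.
move=> Hs; split; first by rewrite /update !eqxx.
by apply: stores_stack_eq Hs => i lt; rewrite /update eqxx /= ltn_eqF.
Qed.

(** [I] is indexed by the part of the list already scanned. The initial 12 credits pay for setting
    [POS] (5) and the failing test (7); each entry costs a test (7), the body and the increment of
    [POS] (5). *)
Lemma run_scan (I : seq (V * status) -> memory -> Prop) body b u m :
  (forall d m', I d m' -> stores_graph m' /\ m' CUR 0 = rank u) ->
  (forall d m' k, I d m' -> I d (update m' POS 0 k)) ->
  (forall d v x d' m', entries u = d ++ (v, x) :: d' ->
     I d m' -> m' 2 (m' POS 0) = rank v -> m' 3 (m' POS 0) = status_code x ->
     run body m' b
       (fun _ m'' => I (rcons d (v, x)) m'' /\ m'' POS 0 = m' POS 0)) ->
  I [::] m ->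
  run (scan body) m (12 + (12 + b) * size (entries u)) (fun=> I (entries u)).
Proof.
move=> IS Ipos Ibody I0; apply/run_seq/run_store => /=; first by lia.
have [[_ off _ _] cur] := IS _ _ I0; rewrite cur off.
pose J p m' := exists d d', [/\ entries u = d ++ d', I d m',
  m' POS 0 = offset u + size d & 7 + (12 + b) * size d' <= p].
apply: (run_while (I := J)); last first.
  exists [::], (entries u); rewrite addn0; split=> //.
  exact: Ipos.
move=> p m' [d [d' [ed Id pos le]]] /=; split; first by lia.
have [[_ _ off' graph] cur'] := IS _ _ Id; rewrite cur' off' pos.
case: d' ed le => [|[v x] d'] ed le.
  by rewrite cats0 in ed; rewrite ed ltnn.
have [e2 e3] := graph _ _ _ _ _ ed; rewrite -pos in e2 e3.
have -> : offset u + size d < offset u + size (entries u).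
  by rewrite ed size_cat /=; lia.
move: le => /= le; apply: run_seq.
have {e2 e3} Hb := Ibody _ _ _ _ _ ed Id e2 e3.
apply: (run_weaken Hb); first by lia.
move=> m'' [Id' pos']; apply: run_store => /=; first by lia.
exists (rcons d (v, x)), d'; split; first by rewrite cat_rcons.
- exact: Ipos.
- by rewrite /update /= pos' pos size_rcons addnS.
- by lia.
Qed.

Definition search_state g m0 s o m : Prop :=
  [/\ stores_graph m,
      m SP 0 = size s /\ stores_stack (m STACK) s,
      m CNT 0 = size o /\ stores_stack (m ORDER) o
    & forall v, m 4 (rank v) = if v \in o then g else m0 4 (rank v)].

Lemma run_push_if_trusted g m0 s o u d v x m :
  search_state g m0 (rev (trusted d) ++ s) o m /\ m CUR 0 = rank u ->
  m 2 (m POS 0) = rank v -> m 3 (m POS 0) = status_code x ->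
  run push_if_trusted m 16 (fun _ m' =>
    (search_state g m0 (rev (trusted (rcons d (v, x))) ++ s) o m' /\
     m' CUR 0 = rank u) /\ m' POS 0 = m POS 0).
Proof.
move=> [[Hg [Hsp Hs] [Hc Ho] H4] Hu] e2 e3; apply: run_if => //=.
rewrite trusted_rcons e3; case: x {e3} => /=; last by apply: run_skip.
apply/run_seq/run_store => //=; apply: run_store => //=.
rewrite {1}/update /= e2 Hsp rev_rcons; split=> //; split=> //; split=> //.
- split; first by rewrite /update /= Hsp.
  exact: (stores_stack_push v Hs).
Qed.

Definition degree_sum : nat := \sum_u size (entries u).

(** [J] speaks of stack and visiting order alone and survives both treatments of a popped vertex;
    this separates memory and credits from the combinatorics of each search. *)
Lemma run_search g m0 (J : seq V -> seq V -> Prop) s0 :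
  (forall u s o, J (u :: s) o -> u \in o -> J s o) ->
  (forall u s o, J (u :: s) o -> u \notin o ->
     J (rev (trusted (entries u)) ++ s) (u :: o)) ->
  J s0 [::] -> search_state g m0 s0 [::] m0 ->
  (forall v, m0 4 (rank v) != g) ->
  run (search g) m0 (4 + 20 * size s0 + 50 * #|V| + 50 * degree_sum)
    (fun _ m => exists2 o, J [::] o & search_state g m0 [::] o m).
Proof.
move=> Jskip Jvisit J0 S0 old.
have sumV : \sum_(u : V) 50 = 50 * #|V| by rewrite sum_nat_const mulnC.
(* A potential: an unvisited vertex holds 50 credits plus 50 per list entry, a stack entry holds 20
   for being popped and skipped. A list entry costs 28 to scan and may put another 20 on the
   stack. *)
pose todo o := \sum_(u | u \notin o) (50 + 50 * size (entries u)).
pose I p m := exists s o,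
  [/\ J s o, search_state g m0 s o m & 4 + 20 * size s + todo o <= p].
apply: (run_while (I := I)); last first.
  exists s0, [::]; split=> //; rewrite /todo (eq_bigl predT) //.
  by rewrite big_split /= -big_distrr /= sumV -/degree_sum !addnA.
move=> p m [s [o [Jso Sso le]]]; split; first by move=> /=; lia.
have [Hg [Hsp Hs] [Hc Ho] H4] := Sso.
case: s Jso Sso Hsp Hs le => [|u s] Jso Sso /= Hsp Hs le; rewrite Hsp //=.
  by exists o.
case: Hs => Hu Hs.
apply/run_seq/run_store => /=; first by lia.
apply/run_seq/run_store => /=; first by lia.
apply: run_if => /=; first by lia.
rewrite /update /= Hsp /= Hu H4; have [uo | uo] := boolP (u \in o).
  rewrite eqxx; apply: run_skip; first by lia.
  exists s, o; split; [exact: Jskip uo | | by lia].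
  by split=> //; split.
rewrite (negPf (old u)).
have todoE : todo o = 50 + 50 * size (entries u) + todo (u :: o).
  rewrite /todo (bigD1 u) //=; congr (_ + _); apply: eq_bigl => v.
  by rewrite inE negb_or andbC.
do 3![apply/run_seq/run_store; first by move=> /=; lia].
have := run_scan (I := fun d m' =>
  search_state g m0 (rev (trusted d) ++ s) (u :: o) m' /\ m' CUR 0 = rank u)
  (body := push_if_trusted) (b := 16) (u := u).
set m1 := update _ _ _ _; move=> /(_ m1) scanP.
apply: (run_weaken (scanP _ _ _ _)) => {scanP}.
- by move=> d m' [[? _ _ _]].
- by move=> d m' k [[? [? ?] [? ?] ?] ?]; split=> //; split=> //; split.
- by move=> d v x d' m' _; apply: run_push_if_trusted.
- rewrite {}/m1 /update /= Hc; split=> //; split=> //=.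
  + by split=> //; have := stores_stack_push u Ho.
  + by move=> v; rewrite inE (inj_eq rank_inj) H4; case: eqP.
- by move=> /=; lia.
move=> m' [S' _]; exists (rev (trusted (entries u)) ++ s), (u :: o); split=> //.
  exact: Jvisit.
have : size (trusted (entries u)) <= size (entries u).
  by rewrite size_map size_filter count_size.
by move=> /=; rewrite size_cat size_rev; lia.
Qed.


Definition neighbors u : seq V := [seq e.1 | e <- entries u].

Lemma run_mark_neighbors m0 o (old : V -> nat) :
  stores_graph m0 -> m0 CNT 0 = size o -> stores_stack (m0 ORDER) o ->
  (forall v, m0 4 (rank v) = if v \in o then 1 else old v) ->
  (forall v, old v != 1) ->
  run mark_neighbors m0 (4 + \sum_(u <- o) (26 + 23 * size (entries u)))
    (fun _ m => forall v, m 4 (rank v) =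
       if v \in o then 1
       else if has (fun u => v \in neighbors u) o then 2 else old v).
Proof.
move=> g0 c0 o0 marks0 old1.
pose marked (hit : pred V) m :=
  forall v, m 4 (rank v) = if v \in o then 1 else if hit v then 2 else old v.
pose hits P := [pred v | has (fun u => v \in neighbors u) P].
pose I p m := exists P s, [/\ o = P ++ s,
  stores_graph m, m CNT 0 = size s /\ stores_stack (m ORDER) s,
  marked (hits P) m
  & 4 + \sum_(u <- s) (26 + 23 * size (entries u)) <= p].
apply: (run_while (I := I)); last by exists [::], o.
move=> p m [P [s [os Hg [Hc Ho] H4 le]]]; split; first by move=> /=; lia.
rewrite /= Hc; case: s os Hc Ho le => [|u s] os /= Hc Ho le.
  by move=> v; rewrite H4 os cats0.
case: Ho => Hu Ho; rewrite big_cons in le.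
apply/run_seq/run_store => /=; first by lia.
apply/run_seq/run_store => /=; first by lia.
rewrite /update /= Hc /= Hu; set m1 := (fun a' => _).
pose Inv (d : seq (V * status)) m := [/\ stores_graph m, m CUR 0 = rank u,
  m CNT 0 = size s /\ stores_stack (m ORDER) s
  & marked [pred v | hits P v || (v \in [seq e.1 | e <- d])] m].
have scanP := @run_scan Inv mark_unless_truthful 11 u m1.
apply: (run_weaken (scanP _ _ _ _)) => {scanP}.
- by move=> d m' [].
- by move=> d m' k [? ? [? ?] ?].
- move=> d v x d' m' ed [Hg' Hu' [Hc' Ho'] H4'] e2 e3; apply: run_if => //=.
  rewrite e2 H4'; have [vo | vo] := boolP (v \in o).
    rewrite eqxx; apply: run_skip => //; split=> //; split=> // w.
    rewrite H4' /= map_rcons mem_rcons inE; case: ifP => //.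
    by case: eqP => // -> ; rewrite vo.
  rewrite [_ == 1](_ : _ = false); last by case: ifP => // _; apply/negbTE.
  apply: run_store => //=; split=> //; split=> // w.
  rewrite /update /= e2 (inj_eq rank_inj) H4' /= map_rcons mem_rcons inE.
  by case: eqP => [-> | _] //=; rewrite (negPf vo) orbT.
- by split=> // v; rewrite [LHS]H4 /= orbF.
- by lia.
move=> m' [Hg' _ Hco' H4']; exists (rcons P u), s; split=> //.
- by rewrite os cat_rcons.
- move=> v; rewrite H4' /= has_rcons; case: (v \in o) => //.
  by rewrite orbC.
- by lia.
Qed.

Lemma run_push_all m0 : stores_graph m0 -> m0 SP 0 = 0 ->
  run push_all m0 (5 + 15 * #|V|) (fun _ m => exists s,
    [/\ stores_graph m, m SP 0 = size s, stores_stack (m STACK) s,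
        m CNT 0 = m0 CNT 0 & m 4 = m0 4] /\ size s = #|V| /\ forall v, v \in s).
Proof.
move=> g0 sp0; set N := #|V|.
pose I p m := exists s,
    [/\ stores_graph m, m SP 0 = size s, stores_stack (m STACK) s,
        m CNT 0 = m0 CNT 0 & m 4 = m0 4] /\
    [/\ size s <= N, forall v, rank v < size s -> v \in s
      & 5 + 15 * (N - size s) <= p].
apply: (run_while (I := I)); last by exists [::]; rewrite subn0.
move=> p m [s [[Hg Hsp Hs Hc H4] [les Hin lep]]]; split; first by move=> /=; lia.
have [e0 _ _ _] := Hg; rewrite /= Hsp e0 -/N; case: ltnP => lts.
  apply/run_seq/run_store => /=; first by lia.
  apply: run_store => /=; first by lia.
  have [v rv] : exists v, rank v = size s.
    by exists (enum_val (Ordinal lts)); rewrite /rank enum_valK.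
  exists (v :: s); rewrite {1}/update /= Hsp; split.
    split=> //; first by rewrite /update /= Hsp.
    by have := stores_stack_push v Hs; rewrite {1}rv.
  split=> //=; last by lia.
  move=> w; rewrite ltnS leq_eqVlt inE => /orP[|/Hin ->]; last by rewrite orbT.
  by rewrite -rv (inj_eq rank_inj) => ->.
have es : size s = N by lia.
exists s; split=> //; split=> // v; apply: Hin; rewrite es.
exact: ltn_ord.
Qed.

Lemma run_halve m0 n : m0 0 0 = n ->
  run halve m0 (11 + 15 * n)
    (fun _ m => (forall a, a < HALF -> m a = m0 a) /\ m HALF 0 = n./2).
Proof.
move=> e0.
apply/run_seq/run_store => /=; first by lia.
apply/run_seq/run_store => /=; first by lia.
pose I p m := [/\ forall a, a < HALF -> m a = m0 a,
  m REST 0 + (m HALF 0).*2 = n & 4 + 15 * m REST 0 <= p].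
apply: (run_while (I := I)); last first.
  rewrite /I /update /= e0; split; [|by rewrite addn0|by lia].
  by move=> a lt; case: eqP => [ea|_]; [|case: eqP => [ea|//]]; rewrite ea in lt.
move=> p m [Ha Hn le]; split; first by move=> /=; lia.
rewrite /=; case: ltnP => lt1; last by split=> //; lia.
apply/run_seq/run_store => /=; first by lia.
apply: run_store => /=; first by lia.
rewrite /I /update /=; split; [|by lia|by lia].
by move=> a lt; rewrite -(Ha a lt); case: eqP => [ea|_];
  [|case: eqP => [ea|//]]; rewrite ea in lt.
Qed.

Lemma nth_flatten_block (W : Type) (f : W -> seq nat) (s1 s2 : seq W) (u : W) d y d' :
  f u = d ++ y :: d' ->
  nth 0 (flatten [seq f w | w <- s1 ++ u :: s2])
    (sumn [seq size (f w) | w <- s1] + size d) = y.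
Proof.
move=> fu; rewrite map_cat /= flatten_cat /= nth_cat size_flatten /shape -map_comp.
rewrite ifN; last by rewrite -leqNgt leq_addr.
by rewrite addKn fu -catA nth_cat ltnn subnn.
Qed.

Lemma enum_split_rank u :
  enum V = take (rank u) (enum V) ++ u :: drop (rank u).+1 (enum V).
Proof.
have lt : rank u < size (enum V) by rewrite -cardE ltn_ord.
by rewrite -{1}(cat_take_drop (rank u) (enum V)) (drop_nth u lt) nth_enum_rank.
Qed.

Lemma input_stores_graph : stores_graph (input r adj).
Proof.
have sz w : size (entries w) = size (adj w) by rewrite size_map.
have off i : i <= #|V| -> input r adj 1 i =
    sumn [seq size (entries w) | w <- take i (enum V)].
  move=> le; transitivity (nth 0 [seq sumn (take k [seq size (adj w) | w <- enum V])
    | k <- iota 0 #|V|.+1] i) => //.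
  rewrite (nth_map 0) ?size_iota // nth_iota //.
  by rewrite add0n -map_take; congr (sumn _); apply: eq_map => w; rewrite sz.
split=> // [u|u|u d v x d' eu].
- by rewrite off // ltnW // ltn_ord.
- rewrite off; last exact: ltn_ord.
  have lt : rank u < size (enum V) by rewrite -cardE ltn_ord.
  by rewrite (take_nth u lt) nth_enum_rank map_rcons sumn_rcons.
have e2 := nth_flatten_block (f := fun w => [seq rank e.1 | e <- entries w])
  (take (rank u) (enum V)) (drop (rank u).+1 (enum V)) (u := u)
  (d := [seq rank e.1 | e <- d]) (y := rank v) (d' := [seq rank e.1 | e <- d']).
have e3 := nth_flatten_block (f := fun w => [seq status_code e.2 | e <- entries w])
  (take (rank u) (enum V)) (drop (rank u).+1 (enum V)) (u := u)
  (d := [seq status_code e.2 | e <- d]) (y := status_code x)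
  (d' := [seq status_code e.2 | e <- d']).
rewrite -enum_split_rank !size_map in e2 e3.
have off_eq (f : V * status -> nat) :
    sumn [seq size [seq f e | e <- entries w] | w <- take (rank u) (enum V)]
    = offset u.
  by congr (sumn _); apply: eq_map => w; rewrite size_map.
rewrite !off_eq in e2 e3.
split.
- rewrite -[RHS]e2 ?eu ?map_cat //; congr (nth _ _ _); congr flatten.
  by apply: eq_map => w; rewrite /entries -map_comp.
- rewrite -[RHS]e3 ?eu ?map_cat //; congr (nth _ _ _); congr flatten.
  by apply: eq_map => w; rewrite /entries -map_comp.
Qed.

End Machine.

(** * Degree sum and number of edges *)

Section Handshake.
Variables (V : finType) (G : sgraph V).

(** [lt] selects at most one orientation of each edge, so forgetting the order is injective. *)
Lemma ordered_pairs_edges (lt : rel V) :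
  (forall u v, lt u v -> ~~ lt v u) ->
  #|[set p : V * V | G p.1 p.2 & lt p.1 p.2]| <= #|edges G|.
Proof.
move=> asym; set A := [set p | _ & _].
have inj : {in A &, injective (fun p : V * V => [set p.1; p.2])}.
  move=> [a b] [c d]; rewrite !inE /= => /andP[_ ab] /andP[_ cd] e.
  have := set21 a b; have := set22 a b; rewrite e !inE.
  move=> /orP[]/eqP eb /orP[]/eqP ea; rewrite ea eb in ab *; rewrite // in cd *;
    by have := asym _ _ ab; rewrite ?cd // ?ab.
rewrite -(card_in_imset inj); apply: subset_leq_card.
apply/subsetP => e /imsetP[p]; rewrite inE => /andP[Gp _] ->.
by rewrite /edges; apply/imsetP; exists p; rewrite ?inE.
Qed.

(** Adjacent ordered pairs are split by which end has the smaller rank; irreflexivity excludes equal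
    ends. *)
Lemma degree_sum_edges (r : report_profile G) (adj : forall u : V, seq (nbr G u)) :
  adjacency_lists adj -> degree_sum r adj <= 2 * #|edges G|.
Proof.
move=> adjP.
have deg u : size (entries r adj u) <= #|[pred v | G u v]|.
  rewrite size_map -card_sig -(card_uniqP (adjP u).1); exact: max_card.
have le1 : degree_sum r adj <= #|[set p : V * V | G p.1 p.2]|.
  rewrite /degree_sum.
  apply: (@leq_trans (\sum_u #|[pred v | G u v]|)); first by apply: leq_sum => u _.
  under eq_bigr do rewrite -sum1_card.
  rewrite pair_big_dep /= -sum1_card; apply: eq_leq.
  by apply: eq_bigl => p; rewrite !inE.
apply: leq_trans le1 _.
pose lt1 : rel V := fun u v => rank u < rank v.
pose lt2 : rel V := fun u v => rank v < rank u.
have le_1 : #|[set p : V * V | G p.1 p.2 & lt1 p.1 p.2]| <= #|edges G|.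
  by apply: ordered_pairs_edges => u v; rewrite /lt1; lia.
have le_2 : #|[set p : V * V | G p.1 p.2 & lt2 p.1 p.2]| <= #|edges G|.
  by apply: ordered_pairs_edges => u v; rewrite /lt2; lia.
rewrite mul2n -addnn; apply: leq_trans (leq_add le_1 le_2).
apply: leq_trans (leq_card_setU _ _); apply: subset_leq_card.
apply/subsetP => -[u v]; rewrite !inE /= => uv; rewrite uv /lt1 /lt2 /= -neq_ltn.
by apply/eqP => /rank_inj e; move: uv; rewrite e adjacent_irrefl.
Qed.

End Handshake.

(** * Depth-first visiting order *)

Section DepthFirst.
Variables (V : finType) (succ : V -> seq V) (K : {set V}).
Hypothesis closedK : forall u v, u \in K -> v \in succ u -> v \in K.
(** Strong connectivity of K along [succ], in the form of closure that the search invariants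
    supply. *)
Hypothesis connK : forall q : seq V,
  (exists2 x, x \in K & x \in q) ->
  (forall u v, u \in K -> u \in q -> v \in succ u -> v \in q) ->
  {subset K <= q}.
Implicit Types (s o : seq V).

(* Until the search enters K, every vertex of K waits on the stack; from then
   on only K is visited until K is exhausted. *)
Definition contiguous s o : Prop := uniq o /\
  [\/ {in o, forall v, v \notin K} /\ {subset K <= s},
      exists top base mid pre,
       [/\ s = top ++ base, o = mid ++ pre,
           {subset top <= K}, {subset mid <= K} &
           [/\ mid != [::], {in pre, forall v, v \notin K} &
           forall u v, u \in mid -> v \in succ u -> v \in mid ++ top]]
    | exists post mid pre, o = post ++ mid ++ pre /\ mid =i K].

Lemma exhausted (q : seq V) : {subset q <= K} -> q != [::] ->
  (forall u v, u \in q -> v \in succ u -> v \in q) -> q =i K.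
Proof.
move=> qK q0 clo v; apply/idP/idP => [/qK // | ].
apply: connK => [|u w _]; last exact: clo.
by case: q qK q0 {clo} => // x q qK _; exists x; [apply: qK|]; rewrite inE eqxx.
Qed.

(** While K is being visited, a skipped vertex of [top] already lies in [mid], so nothing is lost;
    if [top] is empty, [mid] is closed under [succ] and K is exhausted. *)
Lemma contiguous_skip u s o : contiguous (u :: s) o -> u \in o -> contiguous s o.
Proof.
move=> [un [[oK Ks] |
  [top [base [mid [pre [es eo topK midK [mid0 preK clo]]]]]] | C]] uo.
- split=> //; apply: Or31; split=> // v vK; have := Ks v vK; rewrite inE.
  by case/orP=> // /eqP ev; have := oK u uo; rewrite -ev vK.
- case: top es topK clo => [|w top] es topK clo.
    split=> //; apply: Or33; exists [::], mid, pre; split=> //.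
    apply: exhausted => //; by move=> w v wm /(clo _ _ wm); rewrite cats0.
  case: es => ew es; subst w; split=> //; apply: Or32.
  exists top, base, mid, pre; split=> //.
    by move=> v vt; apply: topK; rewrite inE vt orbT.
  split=> // w v wm /(clo _ _ wm); rewrite !mem_cat inE.
  case/or3P=> [-> // | /eqP -> | ->]; last by rewrite orbT.
  move: uo; rewrite eo mem_cat => /orP[-> // | /preK].
  by rewrite topK // inE eqxx.
- by split=> //; apply: Or33.
Qed.

Lemma contiguous_visit u s o : contiguous (u :: s) o -> u \notin o ->
  contiguous (rev (succ u) ++ s) (u :: o).
Proof.
move=> [un H] uo; have un' : uniq (u :: o) by rewrite /= uo.
have C post mid pre : o = post ++ mid ++ pre -> mid =i K ->
    contiguous (rev (succ u) ++ s) (u :: o).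
  move=> eo midK; split=> //; apply: Or33.
  by exists (u :: post), mid, pre; rewrite eo.
case: H => [[oK Ks] | [top [base [mid [pre [es eo topK midK [mid0 preK clo]]]]]] | ].
(* The first visit to K: the old stack becomes [base], the successors of u become [top]. *)
- have [uK | uK] := boolP (u \in K).
    split=> //; apply: Or32; exists (rev (succ u)), s, [:: u], o; split=> //.
    + by move=> v; rewrite mem_rev; apply: closedK.
    + by move=> v; rewrite inE => /eqP ->.
    + split=> // w v; rewrite inE => /eqP -> vs.
      by rewrite mem_cat mem_rev vs orbT.
  split=> //; apply: Or31; split=> [v | v vK].
    by rewrite inE => /orP[/eqP -> // | /oK].
  have := Ks v vK; rewrite inE mem_cat => /orP[/eqP ev | ->]; last by rewrite orbT.
  by rewrite -ev vK in uK.
- case: top es topK clo => [|w top] es topK clo.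
    apply: (C [::] mid pre eo); apply: exhausted => // w v wm /(clo _ _ wm).
    by rewrite cats0.
  case: es => ew es; subst w; have uK : u \in K by rewrite topK // inE eqxx.
  split=> //; apply: Or32; exists (rev (succ u) ++ top), base, (u :: mid), pre.
  split.
  + by rewrite es catA.
  + by rewrite eo.
  + move=> v; rewrite mem_cat mem_rev => /orP[|vt]; first exact: closedK.
    by apply: topK; rewrite inE vt orbT.
  + by move=> v; rewrite inE => /orP[/eqP -> // | /midK].
  split=> // w v; rewrite inE => /orP[/eqP -> vs | wm vs].
    by rewrite !(inE, mem_cat) mem_rev vs !orbT.
  move: (clo w v wm vs); rewrite !(inE, mem_cat).
  by case/or3P=> ->; rewrite ?orbT.
- by move=> [post [mid [pre [eo midK]]]]; apply: C eo midK.
Qed.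

(** K occupies a block of more than n/2 consecutive places among at most n, so the block contains
    the vertex preceded by exactly [#|V|./2] visits, [o2] being the earlier ones. *)
Lemma contiguous_middle s o : contiguous s o -> s = [::] -> #|V| < 2 * #|K| ->
  exists o1 x o2, [/\ o = o1 ++ x :: o2, x \in K & size o2 = #|V|./2].
Proof.
move=> [un H] s0 bigK.
have [x0 x0K] : exists x, x \in K by apply/card_gt0P; lia.
have [post [mid [pre [eo midK]]]] :
    exists post mid pre, o = post ++ mid ++ pre /\ mid =i K.
  case: H => // [[_ /(_ x0 x0K)] | [top [base [mid [pre []]]]]]; first by rewrite s0.
  rewrite s0; case: top => // _ eo _ midK [mid0 preK clo].
  exists [::], mid, pre; split=> //; apply: exhausted => // u v um /(clo _ _ um).
  by rewrite cats0.
have szm : size mid = #|K|.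
  move: un; rewrite eo !cat_uniq => /and4P[_ _ um _].
  by rewrite -(card_uniqP um); apply: eq_card.
have szo : size o <= #|V| by rewrite -(card_uniqP un) max_card.
rewrite eo !size_cat szm in szo.
(* Chosen so that the part of [mid] after index k, together with [pre], has length [#|V|./2]. *)
pose k := size mid - (#|V|./2 - size pre).+1.
have klt : k < size mid by rewrite /k; lia.
exists (post ++ take k mid), (nth x0 mid k), (drop k.+1 mid ++ pre); split.
- rewrite eo -catA -cat_cons -(drop_nth x0 klt) catA [take _ _ ++ _]catA.
  by rewrite cat_take_drop -catA.
- by rewrite -midK mem_nth.
- by rewrite size_cat size_drop /k; lia.
Qed.

(** Invariant of the second search: it never leaves K, and every successor of a visited vertex is
    visited or waiting. *)
Definition within x s o : Prop :=
  [/\ uniq o, {subset s <= K}, {subset o <= K}, x \in o ++ s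
    & forall u v, u \in o -> v \in succ u -> v \in o ++ s].

Lemma within_skip x u s o : within x (u :: s) o -> u \in o -> within x s o.
Proof.
move=> [un sK oK xos clo] uo.
have sub v : v \in o ++ u :: s -> v \in o ++ s.
  by rewrite !mem_cat inE; case: eqP => [-> | _]; rewrite ?uo.
split=> // [v vs|| w v wo vw]; [|exact: sub|by apply: sub; exact: clo vw].
by apply: sK; rewrite inE vs orbT.
Qed.

Lemma within_visit x u s o : within x (u :: s) o -> u \notin o ->
  within x (rev (succ u) ++ s) (u :: o).
Proof.
move=> [un sK oK xos clo] uo; have uK : u \in K by rewrite sK // inE eqxx.
have sub v : v \in o ++ u :: s -> v \in (u :: o) ++ rev (succ u) ++ s.
  by rewrite !(mem_cat, inE) => /or3P[] ->; rewrite ?orbT.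
split.
- by rewrite /= uo.
- move=> v; rewrite mem_cat mem_rev => /orP[|vs]; first exact: closedK.
  by apply: sK; rewrite inE vs orbT.
- by move=> v; rewrite inE => /orP[/eqP -> // | /oK].
- exact: sub.
- move=> w v; rewrite inE => /orP[/eqP -> vu | wo vw]; last first.
    by apply: sub; exact: clo vw.
  by rewrite !(mem_cat, inE) mem_rev vu !orbT.
Qed.

Lemma within_final x o : within x [::] o -> o =i K.
Proof.
move=> [_ _ oK]; rewrite cats0 => xo clo; apply: exhausted => //.
by case: o xo {oK clo}.
Qed.


End DepthFirst.

(** * The linear-time algorithm when the giant component is a majority *)

Section Majority.
Variables (V : finType) (G : sgraph V) (r : report_profile G).
Variable adj : forall u : V, seq (nbr G u).
Hypothesis adjP : adjacency_lists adj.
Variables (T : {set V}) (x0 : V).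
Hypotheses (conT : consistentb r T) (x0T : x0 \in T).
Let K : {set V} := component G T x0.
Hypothesis bigK : #|V| < 2 * #|K|.

Lemma mem_neighbors u v : (v \in neighbors r adj u) = G u v.
Proof.
rewrite /neighbors /entries -map_comp.
apply/mapP/idP => [[w _ ->] | uv]; first exact: (valP w).
by exists (exist _ v uv) => //; exact: (adjP u).2.
Qed.

(** Reports of truthful vertices are correct, which turns the search arcs leaving T-vertices into
    the edges of G[T]. *)
Lemma mem_trusted u v : u \in T ->
  (v \in trusted (entries r adj u)) = G u v && (v \in T).
Proof.
move=> uT; have con w := eqP (forallP (forall_inP conT u uT) w).
rewrite /trusted /entries filter_map -map_comp.
apply/mapP/andP => [[w] | [uv vT]].
  rewrite mem_filter /= => /andP[tw _] ->; rewrite -con tw.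
  by split; first exact: (valP w).
exists (exist _ v uv) => //; rewrite mem_filter /= con vT.
exact: (adjP u).2.
Qed.

Let succ u := trusted (entries r adj u).

Lemma component_succ u v : u \in K -> v \in succ u -> v \in K.
Proof.
move=> uK; rewrite mem_trusted; last by apply: subsetP uK; apply: component_sub.
by case/andP=> uv vT; apply: component_closed uK vT uv.
Qed.

Lemma component_succ_conn (q : seq V) :
  (exists2 x, x \in K & x \in q) ->
  (forall u v, u \in K -> u \in q -> v \in succ u -> v \in q) ->
  {subset K <= q}.
Proof.
move=> [x xK xq] clo; have sub : component G T x \subset [set v in K | v \in q].
  apply: component_min; first by rewrite in_set xK.
  move=> u v; rewrite in_set => /andP[uK uq] vT uv; rewrite in_set.
  have uT : u \in T by apply: subsetP uK; apply: component_sub.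
  have vs : v \in succ u by rewrite mem_trusted // uv.
  by rewrite (component_succ uK vs) (clo u).
move=> v vK; have := subsetP sub v.
by rewrite (component_eq xK) in_set => /(_ vK) /andP[].
Qed.

(** With N vertices, E edges and degree sum D, the budgets add up to 176 N + 123 D + 59, which is at
    most 235 N + 246 E since D is at most 2 E and N is positive. *)
Lemma run_identify_majority :
  run identify_majority (input r adj) (250 * graph_size G)
    (fun _ m => output V m Truthful = K /\ output V m Corrupt = outer_nbrs G K).
Proof.
have degE := degree_sum_edges r adjP.
set D := degree_sum r adj in degE; set E := #|edges G| in degE.
have V_gt0 : 0 < #|V| by apply/card_gt0P; exists x0.
rewrite /graph_size -/E; move: V_gt0 bigK; set N := #|V| => V_gt0 bigN.
have g0 := input_stores_graph r adj.
have out0 i : input r adj 4 i = 0 by rewrite /input /memory_of /= nth_nil.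
apply: run_seq; apply: (run_weaken (run_push_all g0 _)) => //.
  by rewrite -/N; lia.
move=> m1 [s [[g1 sp1 st1 cnt1 out1] [szs ins]]]; rewrite -/N in szs *.
apply: run_seq.
have S1 : search_state r adj 3 m1 s [::] m1 by split=> //; rewrite cnt1.
have := run_search (contiguous_skip component_succ_conn)
  (contiguous_visit component_succ component_succ_conn) _ S1.
move=> H; apply: (run_weaken (H _ _)) => {H}.
- by split=> //; apply: Or31; split.
- by move=> v; rewrite out1 out0.
- by rewrite szs -/N -/D; lia.
move=> m2 [o J2 [g2 _ [_ ord2] out2]].
have [o1 [x [o2 [eo xK szo]]]] := contiguous_middle component_succ_conn J2 erefl bigK.
have [n2 _ _ _] := g2.
apply: run_seq; apply: (run_weaken (run_halve n2)); first by rewrite szs -/N -/D; lia.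
move=> m3 [same half]; rewrite szs -/N -/D.
do 3![apply/run_seq/run_store; first by move=> /=; lia].
set m4 := update _ _ _ _.
have S4 : search_state r adj 1 m4 [:: x] [::] m4.
  split=> //.
  + move: g2; rewrite /stores_graph /m4 /update /= !same //.
  (* Indices start at 0, so the cell of [ORDER] at [#|V|./2] holds the vertex visited right after
     those of [o2], namely x. *)
  + split=> //=; split=> //; rewrite /m4 /update /= same // half -szo.
    by rewrite eo in ord2; rewrite (stores_stack_nth ord2).
have := run_search (within_skip (x := x)) (within_visit component_succ (x := x)) _ S4.
move=> H; apply: run_seq; apply: (run_weaken (H _ _)) => {H}.
- split=> //; last by rewrite inE.
  by move=> v; rewrite inE => /eqP ->.
- by move=> v; rewrite /m4 /update /= same // out2 out1 out0; case: ifP.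
- by rewrite /= -/N -/D; lia.
move=> m5 [o' J5 [g5 _ [cnt5 ord5] out5]].
have oK := within_final component_succ_conn J5.
(* Leftover values are neither the new tag 1 nor the code 2, so they are never read as output. *)
have old v : m4 4 (rank v) = if v \in o then 3 else 0.
  by rewrite /m4 /update /= same // out2 out1 out0.
have bnd : \sum_(u <- o') (26 + 23 * size (entries r adj u)) <= 26 * N + 23 * D.
  have [un _ _ _ _] := J5; rewrite big_uniq //=.
  apply: (@leq_trans (\sum_u (26 + 23 * size (entries r adj u)))).
    by rewrite [leqRHS](bigID (mem o')) /= leq_addr.
  by rewrite big_split /= -big_distrr /= sum_nat_const mulnC.
apply: (run_weaken (run_mark_neighbors g5 cnt5 ord5 out5 _)).
- by move=> v; rewrite old; case: ifP.
- by rewrite /= -/N -/D; lia.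
have hit v : v \notin K ->
    has (fun u => v \in neighbors r adj u) o' = (v \in outer_nbrs G K).
  move=> vK; rewrite in_set vK /=; apply/hasP/exists_inP => -[u].
    by rewrite oK mem_neighbors; exists u.
  by exists u; rewrite ?oK ?mem_neighbors.
move=> m6 out6; split; apply/setP => v; rewrite in_set [m6 _ _]out6 oK old.
  by case: ifPn => // vK; do 2![case: ifP => //].
case: ifPn => [vK | /hit ->]; last by do 2![case: ifP => //].
by rewrite in_set vK.
Qed.

End Majority.

Local Open Scope ring_scope.

Theorem theorem1p1 (R : realFieldType) (delta : R)
    (delta_gt0 : 0 < delta) (delta_lt : delta < 1 / 8) :
  (forall (V : finType) (G : sgraph V), good_expander delta G ->
     exists procedure : report_profile G -> {set V} * {set V},
       (forall r, (procedure r).1 :&: (procedure r).2 = set0) /\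
       forall T B : {set V}, bipartition T B -> (#|B| < #|T|)%N ->
       forall r : report_profile G, consistent r T B ->
         [/\ (procedure r).1 \subset T,
             (procedure r).2 \subset B
           & (1 - delta) * #|V|%:R
               < #|(procedure r).1 :|: (procedure r).2|%:R])
  /\
  (exists (algorithm : cmd) (c : nat),
     forall (V : finType) (G : sgraph V), good_expander delta G ->
     forall T B : {set V}, bipartition T B ->
       (1 / 2 + delta) * #|V|%:R < #|T|%:R ->
     forall r : report_profile G, consistent r T B ->
     forall adj : (forall u : V, seq (nbr G u)), adjacency_lists adj ->
     exists (t : nat) (m : memory),
       [/\ exec algorithm (input r adj) t m,
           (t <= c * graph_size G)%N,
           output V m Truthful \subset T,
           output V m Corrupt \subset B
         & (1 - delta) * #|V|%:R
             < #|output V m Truthful :|: output V m Corrupt|%:R]).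
Proof.
split.
  move=> V G expG; exists (@identify V G); split; first exact: identify_disjoint.
  by move=> T B bip maj r con; exact: identifyP.
exists identify_majority, 250%N => V G expG T B bip bigT r con adj adjP.
have conT := consistentbP bip con; have eB := bipartition_setC bip.
have n_ge0 : 0 <= delta * #|V|%:R by rewrite mulr_ge0 ?ler0n // ltW.
have maj : (#|V| < 2 * #|T|)%N by rewrite -(ltr_nat R) natrM; lra.
have [x xT bigK] := giant_component delta_gt0 delta_lt expG maj.
(* The surplus of [delta] n in |T| pays for the vertices of T outside the giant component, which is
   therefore itself a majority. *)
have bigK2 : (#|V| < 2 * #|component G T x|)%N by rewrite -(ltr_nat R) natrM; lra.
have [t [m [p [E le [outT outB]]]]] := run_identify_majority adjP conT xT bigK2.
exists t, m; rewrite outT outB; split=> //; first by lia.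
- exact: component_sub.
- by rewrite eB outer_nbrs_component.
- by apply: component_nbrs_cover => //; lia.
Qed.
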